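(* Let $n\ge 2$, $r>0$, $f\in C(I_n)$ where $I_n=\{\bm{x}\in\mathbb{R}^n: |x_i|\le r,\ i=1,\dots,n\}$, and let $h^f_*\in\mathcal{H}_-(I_n,f)$. Assume that $f-h^f_*=0$ on $D_n$. Then $h^f_*$ is a best one-sided $L^1$-approximant from below to $f$ with respect to $\mathcal{H}(I_n)$, i.e. $\|f-h^f_*\|_1\le\|f-h\|_1$ for every $h\in\mathcal{H}_-(I_n,f)$.
   Context: $\mathcal{H}(I_n)$ is the space of functions harmonic ($C^2$ with vanishing Laplacian) in some domain containing $I_n$; $\mathcal{H}_-(I_n,f)=\{h\in\mathcal{H}(I_n): h\le f \text{ on } I_n\}$; $\|g\|_1=\int_{I_n}|g|\,d\lambda_n$ with $\lambda_n$ Lebesgue measure. For $1\le i<j\le n$, $D^{ij}_n=\{\bm{x}\in I_n : |x_k|\le |x_i|=|x_j| \text{ for all } k\ne i,j\}$, and $D_n=\bigcup_{1\le i<j\le n}D^{ij}_n$. *)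

(* Defs.v *)
From HB Require Import structures.
From mathcomp Require Import all_boot all_order all_algebra.
From mathcomp Require Import all_classical all_reals all_analysis.
Set Implicit Arguments. Unset Strict Implicit. Unset Printing Implicit Defensive.
Import Order.TTheory GRing.Theory Num.Theory.
Import numFieldNormedType.Exports.
Local Open Scope classical_set_scope.
Local Open Scope ring_scope.

Section Defs.
Variables (R : realType) (n : nat).
Implicit Types (f g : 'rV[R]_n -> R) (x : 'rV[R]_n) (U : set 'rV[R]_n).

Definition evec (i : 'I_n) : 'rV[R]_n := delta_mx 0 i.

Definition pd (i : 'I_n) g : 'rV[R]_n -> R := fun x => 'D_(evec i) g x.

Definition cube (r : R) : set 'rV[R]_n := [set x | forall i, `|x 0 i| <= r].

Definition C2_on U g : Prop :=
  forall x, U x ->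
    {for x, continuous g} /\
    forall i j : 'I_n,
      [/\ derivable g x (evec i), {for x, continuous (pd i g)},
          derivable (pd i g) x (evec j) & {for x, continuous (pd j (pd i g))}].

Definition laplacian g : 'rV[R]_n -> R := fun x => \sum_(i < n) pd i (pd i g) x.

Definition harmonic_near (K : set 'rV[R]_n) g : Prop :=
  exists U : set 'rV[R]_n, [/\ open U, K `<=` U, C2_on U g &
    forall x, U x -> laplacian g x = 0].

Definition harm_minorant (r : R) f h : Prop :=
  harmonic_near (cube r) h /\ forall x, cube r x -> h x <= f x.

Definition Dij (r : R) (i j : 'I_n) : set 'rV[R]_n :=
  [set x | cube r x /\ `|x 0 i| = `|x 0 j| /\
           forall k, k != i -> k != j -> `|x 0 k| <= `|x 0 i|].
Definition Dn (r : R) : set 'rV[R]_n :=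
  [set x | exists i j : 'I_n, (i < j)%N /\ Dij r i j x].

Definition setcoord (k : nat) (t : R) x : 'rV[R]_n :=
  \row_(j < n) (if (j : nat) == k then t else x 0 j).

Fixpoint iint (r : R) (k : nat) g x : R :=
  match k with
  | 0%N => g x
  | k'.+1 => Rintegral lebesgue_measure `[- r, r]%classic
               (fun t => iint r k' g (setcoord k' t x))
  end.

(* integral over the cube I_n w.r.t. Lebesgue measure lambda_n,
   computed as an iterated integral (Fubini) *)
Definition cube_integral (r : R) g : R := iint r n g 0.

Definition L1norm (r : R) g : R := cube_integral r (fun x => `|g x|).

End Defs.

(* Main.v *)
Require Import Defs.
From HB Require Import structures.
From mathcomp Require Import all_boot all_order all_algebra.
From mathcomp Require Import all_classical all_reals all_analysis.
From mathcomp Require Import measurable_realfun lra ring.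
Import Order.TTheory GRing.Theory Num.Theory.
Import numFieldNormedType.Exports.
Local Open Scope classical_set_scope.
Local Open Scope ring_scope.

(* Let [|x|] be the sup norm and [u x = (r - |x|)^2 / 2].  Both [u] and its
   gradient vanish on the boundary of the cube, and the Laplacian of [u] is [1]
   minus a nonnegative measure carried by [Dn r], where the gradient jumps.  Green's
   formula thus expresses the integral over the cube of a harmonic function as a
   nonnegative combination of its values on [Dn r].  Since [hstar = f >= h] there,
   the integral of [hstar - h] is nonnegative.  Green's formula is obtained one
   coordinate at a time: for fixed other coordinates, with maximal modulus [m],
   integration by parts in the [i]-th one leaves the integral over [|x_i| >= m] and
   point terms at [x_i = m] and [x_i = - m], which lie in [Dn r]; and the regions
   where the [i]-th coordinate has maximal modulus tile the cube. *)

Section SetCoord.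
Context {R : realType} {n : nat}.
Implicit Types (x : 'rV[R]_n) (i : 'I_n).

Lemma setcoordC k l (s t : R) x : k != l ->
  setcoord k s (setcoord l t x) = setcoord l t (setcoord k s x).
Proof.
move=> kl; apply/rowP => j; rewrite !mxE.
by case: eqP => [->|//]; rewrite (negbTE kl).
Qed.

Lemma setcoord_row k (s : R) (v : 'I_n -> R) :
  setcoord k s (\row_j v j) = \row_j (if (j : nat) == k then s else v j).
Proof. by apply/rowP => j; rewrite !mxE; case: ifP => // _; rewrite mxE. Qed.

Lemma setcoord_delta i (s t : R) x :
  setcoord i (s + t) x = s *: evec R i + setcoord i t x.
Proof.
apply/rowP => j; rewrite !mxE eqxx /=.
case: (eqVneq j i) => [->|ji]; first by rewrite eqxx mulr1.
by rewrite -val_eqE /= in ji; rewrite (negbTE ji) mulr0 add0r.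
Qed.

Lemma cube_setcoord (r : R) k (t : R) x : cube r x -> t \in `[- r, r] ->
  cube r (setcoord k t x).
Proof.
move=> cx; rewrite in_itv/= => tr j; rewrite mxE; case: ifP => // _.
by rewrite ler_norml.
Qed.

End SetCoord.

Section CoordMeasurable.
Context {R : realType} {n : nat}.
Implicit Types (F G : 'rV[R]_n -> R) (x : 'rV[R]_n).

(* Borel measurability on R^n, phrased so that no sigma-algebra on ['rV[R]_n] is needed. *)
Definition coord_measurable F : Prop :=
  forall d (T : measurableType d) (phi : 'I_n -> T -> R),
    (forall j, measurable_fun setT (phi j)) ->
    measurable_fun setT (fun t => F (\row_j phi j t)).

Definition bounded_measurable F : Prop :=
  coord_measurable F /\ exists C, forall x, `|F x| <= C.

Lemma bmeasB F G : bounded_measurable F -> bounded_measurable G ->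
  bounded_measurable (fun x => F x - G x).
Proof.
move=> [mF [C FC]] [mG [D GD]]; split.
  by move=> d T phi mphi; apply: measurable_funB; [exact: mF | exact: mG].
by exists (C + D) => x; rewrite (le_trans (ler_normB _ _))// lerD.
Qed.

Lemma bmeasM F G : bounded_measurable F -> bounded_measurable G ->
  bounded_measurable (fun x => F x * G x).
Proof.
move=> [mF [C FC]] [mG [D GD]]; split.
  by move=> d T phi mphi; apply: measurable_funM; [exact: mF | exact: mG].
by exists (C * D) => x; rewrite normrM ler_pM.
Qed.

Lemma bmeas_sum (I : finType) (F : I -> 'rV[R]_n -> R) :
  (forall i, bounded_measurable (F i)) ->
  bounded_measurable (fun x => \sum_i F i x).
Proof.
move=> mF; split.
  by move=> d T phi mphi; apply: measurable_sum => i; exact: (mF i).1.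
have /choice [C FC] : forall i, exists C, forall x, `|F i x| <= C.
  by move=> i; exact: (mF i).2.
exists (\sum_i C i) => x.
by rewrite (le_trans (ler_norm_sum _ _ _))// ler_sum.
Qed.

Lemma continuous_coord_measurable F : continuous F -> coord_measurable F.
Proof.
move=> cF d T phi mphi; apply: (measurability _ (RGenOpens.measurableE R)).
move=> _ [_ [a [b ->] <-]]; rewrite setTI.
have oF : open (F @^-1` `]a, b[%classic) by move/continuousP: cF; apply; exact: interval_open.
pose box (vq : 'rV[rat]_n * rat) : set T :=
  [set t | forall j, `|phi j t - ratr (vq.1 0 j)| < ratr vq.2].
pose good := [set vq : 'rV[rat]_n * rat | box vq `<=` (fun t => F (\row_j phi j t)) @^-1` `]a, b[].
suff -> : (fun t => F (\row_j phi j t)) @^-1` `]a, b[ = \bigcup_(vq in good) box vq.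
  rewrite bigcup_mkcond; apply: countable_bigcupT_measurable; first exact: countableP.
  move=> vq; case: ifP => _; last exact: measurable0.
  rewrite (_ : box vq = \bigcap_(j in [set: 'I_n])
      [set t | `|phi j t - ratr (vq.1 0 j)| < ratr vq.2]); last first.
    by apply/seteqP; split => t /= h j; [move=> _|]; exact: h.
  apply: fin_bigcap_measurable => // j _.
  have mj : measurable_fun setT (fun t => `|phi j t - ratr (vq.1 0 j)|).
    by apply: measurableT_comp => //; apply: measurable_funB.
  have := mj measurableT _ (measurable_itv `]-oo, ratr vq.2[); rewrite setTI.
  by congr (measurable _); apply/seteqP; split => t /=; rewrite in_itv.
apply/seteqP; split => [t /= Ft|t [vq gvq]]; last exact: gvq.
have /nbhs_ballP[e /= e0 eF] : nbhs (\row_j phi j t) (F @^-1` `]a, b[%classic).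
  exact: open_nbhs_nbhs.
have [q] : exists q, ratr q \in `]0, e / 2[ by apply: rat_in_itvoo; rewrite divr_gt0.
rewrite in_itv/= => /andP[q0 qe].
have /choice[v vP] : forall j, exists v : rat, `|phi j t - ratr v| < ratr q.
  move=> j; have [v] : exists v, ratr v \in `]phi j t - ratr q, phi j t + ratr q[.
    by apply: rat_in_itvoo; lra.
  by rewrite in_itv/= => /andP[v1 v2]; exists v; rewrite ltr_norml; lra.
exists (\row_j v j, q) => [s /= bs|j /=]; last by rewrite mxE; exact: vP.
apply: eF; split => // i j; rewrite !mxE -ball_normE /=.
have := bs j; rewrite /= mxE; have := vP j.
rewrite !ltr_norml => /andP[? ?] /andP[? ?]; apply/andP; split; lra.
Qed.

End CoordMeasurable.

Section ParameterIntegral.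
Context {R : realType}.
Notation mu := (@lebesgue_measure R).

Lemma bounded_measurable_integrable (D : set R) (g : R -> R) (C : R) :
  measurable D -> (mu D < +oo)%E -> measurable_fun setT g ->
  (forall t, `|g t| <= C) -> mu.-integrable D (EFin \o g).
Proof.
move=> mD Doo mg gC; apply: measurable_bounded_integrable => //.
  exact: measurable_funTS.
exists C; split; first exact: num_real.
by move=> M CM t _ /=; exact: le_trans (gC t) (ltW CM).
Qed.

Lemma measurable_Rintegral_param d (T : measurableType d) (D : set R)
    (G : T * R -> R) : measurable D -> measurable_fun setT G ->
  measurable_fun setT (fun t => Rintegral mu D (fun s => G (t, s))).
Proof.
move=> mD mG.
pose g (z : T * R) := (G z * \1_D z.2)%:E.
have mg : measurable_fun setT g.
  apply/measurable_EFinP; apply: measurable_funM => //.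
  by apply: measurableT_comp; [exact: measurable_indic|exact: measurable_snd].
have -> : (fun t => Rintegral mu D (fun s => G (t, s))) =
    fine \o (fubini_F mu g^\+ \- fubini_F mu g^\-)%E.
  apply/funext => t /=; rewrite /Rintegral integral_mkcond; congr fine.
  have -> : (\int[mu]_s ((fun s => (G (t, s))%:E) \_ D) s = \int[mu]_s g (t, s))%E.
    apply: eq_integral => s _; rewrite /g patchE indicE.
    by case: ifPn => _; rewrite ?mulr1 ?mulr0.
  by rewrite integralE /fubini_F; under eq_integral do rewrite funepos_comp/=;
    under [X in (_ - X)%E]eq_integral do rewrite funeneg_comp/=.
have mfine : measurable_fun setT (@fine R) by exact: fine_measurable.
apply: (measurableT_comp mfine).
by apply: emeasurable_funB; apply: measurable_fun_fubini_tonelli_F => //;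
  [exact: measurable_funepos|exact: measurable_funeneg].
Qed.

Lemma Rintegral_swap (D : set R) (G : R * R -> R) (C : R) :
  measurable D -> (mu D < +oo)%E -> measurable_fun setT G ->
  (forall z, `|G z| <= C) ->
  Rintegral mu D (fun s => Rintegral mu D (fun t => G (s, t))) =
  Rintegral mu D (fun t => Rintegral mu D (fun s => G (s, t))).
Proof.
move=> mD Doo mG GC.
pose f := (EFin \o G) \_ (D `*` D).
have intf : (mu \x mu)%E.-integrable setT f.
  have mDD : measurable (D `*` D) by exact: measurableX.
  have := @integrable_mkcond _ _ _ (mu \x mu)%E _ (EFin \o G) mDD.
  rewrite -/f => <-; apply: measurable_bounded_integrable => //.
  - rewrite [X in (X < _)%E](_ : _ = (mu D * mu D)%E); last exact: product_measure1E.
    by apply: lte_mul_pinfty => //; rewrite ge0_fin_numE.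
  - exact: measurable_funTS.
  - exists C; split; first exact: num_real.
    by move=> M CM t _ /=; exact: le_trans (GC t) (ltW CM).
have E1 s : (\int[mu]_t f (s, t) =
    ((fun s => (Rintegral mu D (fun t => G (s, t)))%:E) \_ D) s)%E.
  rewrite patchE; case: ifPn => sD; last first.
    by apply: integral0_eq => t _; rewrite /f patchE in_setX (negbTE sD).
  rewrite /Rintegral fineK.
    rewrite [RHS]integral_mkcond; apply: eq_integral => t _; rewrite /f !patchE.
    by rewrite in_setX sD.
  apply: integrable_fin_num => //; apply: (bounded_measurable_integrable _ _ C) => //.
  exact: measurable_fun_pair2.
have E2 t : (\int[mu]_s f (s, t) =
    ((fun t => (Rintegral mu D (fun s => G (s, t)))%:E) \_ D) t)%E.
  rewrite patchE; case: ifPn => sD; last first.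
    by apply: integral0_eq => s _; rewrite /f patchE in_setX (negbTE sD) andbF.
  rewrite /Rintegral fineK.
    rewrite [RHS]integral_mkcond; apply: eq_integral => s _; rewrite /f !patchE.
    by rewrite in_setX sD andbT.
  apply: integrable_fin_num => //; apply: (bounded_measurable_integrable _ _ C) => //.
  exact: measurable_fun_pair1.
rewrite {1}/Rintegral [RHS]/Rintegral; congr fine.
rewrite integral_mkcond [RHS]integral_mkcond.
under eq_integral do rewrite -E1.
under [RHS]eq_integral do rewrite -E2.
exact: Fubini.
Qed.

End ParameterIntegral.

Section SliceIntegral.
Context {R : realType} {n : nat} (r : R).
Notation mu := (@lebesgue_measure R).
Implicit Types (F G : 'rV[R]_n -> R) (x : 'rV[R]_n).

Definition slice_int k F x : R :=
  Rintegral mu `[- r, r]%classic (fun t => F (setcoord k t x)).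

Lemma mu_itv_lty : (mu [set` `[(- r)%R, r]] < +oo)%E.
Proof. by rewrite lebesgue_measure_itv/=; case: ifP => _; rewrite ?ltry. Qed.

Lemma coord_measurable_setcoord k F x : coord_measurable F ->
  measurable_fun setT (fun t : R => F (setcoord k t x)).
Proof.
move=> mF; apply: (mF _ _ (fun j t => if (j : nat) == k then t else x 0 j)) => j.
by case: eqP => _.
Qed.

Lemma integrable_slice k F x : bounded_measurable F ->
  mu.-integrable `[- r, r]%classic (EFin \o (fun t => F (setcoord k t x))).
Proof.
move=> [mF [C FC]]; apply: (bounded_measurable_integrable _ _ C) => //.
- exact: mu_itv_lty.
- exact: coord_measurable_setcoord.
Qed.

Lemma bmeas_slice k F : bounded_measurable F -> bounded_measurable (slice_int k F).
Proof.
move=> mbF; have [mF [C FC]] := mbF; split.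
  move=> d T phi mphi.
  pose psi (j : 'I_n) (z : T * R) := if (j : nat) == k then z.2 else phi j z.1.
  rewrite (_ : (fun t => _) = fun t => Rintegral mu `[- r, r]%classic
      (fun s => (fun z => F (\row_j psi j z)) (t, s))); last first.
    by apply/funext => t; apply: eq_Rintegral => s _; rewrite setcoord_row.
  apply: (measurable_Rintegral_param _ _ _ (fun z => F (\row_j psi j z))) => //.
  apply: mF => j; rewrite /psi; case: eqP => _; first exact: measurable_snd.
  by apply: measurableT_comp => //; exact: measurable_fst.
exists (C * fine (mu `[- r, r]%classic)) => x.
have iF := integrable_slice k _ x mbF.
rewrite (le_trans (le_normr_Rintegral _ iF))// -Rintegral_cst//.
apply: le_Rintegral => //; first by have := integrable_norm iF; apply.
apply: (bounded_measurable_integrable _ _ `|C|) => //; exact: mu_itv_lty.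
Qed.

Lemma slice_intC k l F x : bounded_measurable F -> k != l ->
  slice_int k (slice_int l F) x = slice_int l (slice_int k F) x.
Proof.
move=> [mF [C FC]] kl; rewrite /slice_int.
pose G (z : R * R) := F (setcoord k z.1 (setcoord l z.2 x)).
transitivity (Rintegral mu `[- r, r]%classic (fun s =>
    Rintegral mu `[- r, r]%classic (fun t => G (s, t)))).
  by apply: eq_Rintegral => s _; apply: eq_Rintegral => t _; rewrite setcoordC// eq_sym.
suff mG : measurable_fun setT G.
  rewrite (Rintegral_swap _ _ C)//; [exact: mu_itv_lty|by move=> z; exact: FC].
have -> : G = fun z => F (\row_j (if (j : nat) == k then z.1 else
    if (j : nat) == l then z.2 else x 0 j)).
  apply/funext => z; rewrite /G; congr F; apply/rowP => j; rewrite !mxE.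
  by case: ifP => // _; rewrite mxE.
apply: mF => j; case: eqP => _; first exact: measurable_fst.
by case: eqP => _; [exact: measurable_snd|exact: measurable_cst].
Qed.

Lemma slice_int_ge0 k F x : (forall y, cube r y -> 0 <= F y) -> cube r x ->
  0 <= slice_int k F x.
Proof. by move=> F0 cx; apply: Rintegral_ge0 => t tr; apply/F0/cube_setcoord. Qed.

Lemma eq_slice_int k F G x : (forall y, cube r y -> F y = G y) -> cube r x ->
  slice_int k F x = slice_int k G x.
Proof.
move=> FG cx; apply: eq_Rintegral => t; rewrite inE => tr.
exact/FG/cube_setcoord.
Qed.

Lemma bmeas_iint k F : bounded_measurable F -> bounded_measurable (iint r k F).
Proof. by move=> mF; elim: k => //= k IH; exact: bmeas_slice. Qed.

Lemma eq_iint k F G x : (forall y, cube r y -> F y = G y) -> cube r x ->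
  iint r k F x = iint r k G x.
Proof.
by move=> FG; elim: k x => [|k IH] x cx; [exact: FG|exact: eq_slice_int].
Qed.

Lemma iintB k F G x : bounded_measurable F -> bounded_measurable G ->
  iint r k (fun y => F y - G y) x = iint r k F x - iint r k G x.
Proof.
move=> mF mG; elim: k x => [//|k IH] x /=.
under eq_Rintegral do rewrite IH.
by rewrite RintegralB//; apply: integrable_slice; exact: bmeas_iint.
Qed.

Lemma iint_sum k (I : finType) (F : I -> 'rV[R]_n -> R) x :
  (forall i, bounded_measurable (F i)) ->
  iint r k (fun y => \sum_i F i y) x = \sum_i iint r k (F i) x.
Proof.
move=> mF; elim: k x => [//|k IH] x /=.
under eq_Rintegral do rewrite IH.
pose f i t := iint r k (F i) (setcoord k t x).
have intf i : mu.-integrable `[- r, r]%classic (EFin \o f i).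
  exact/integrable_slice/bmeas_iint.
elim: (index_enum I) => [|i s IHs].
  by rewrite big_nil; under eq_Rintegral do rewrite big_nil; rewrite /Rintegral integral0.
rewrite big_cons; under eq_Rintegral do rewrite big_cons.
rewrite RintegralD// ?IHs//; first exact: intf.
rewrite (_ : _ \o _ = fun t => (\sum_(j <- s) (f j t)%:E)%E); last first.
  by apply/funext => t /=; rewrite sumEFin.
by apply: integrable_sum => // j _; exact: intf.
Qed.

(* Fubini moves the [i]-th integration innermost, so only its sign matters. *)
Lemma iint_ge0 k i F x : bounded_measurable F -> (i < k)%N ->
  (forall y, cube r y -> 0 <= slice_int i F y) -> cube r x -> 0 <= iint r k F x.
Proof.
move=> mF ik Fi.
have Fk : forall l, (l <= i)%N -> forall y, cube r y -> 0 <= slice_int i (iint r l F) y.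
  elim=> [|l IH] li y cy; first exact: Fi.
  rewrite -[iint r l.+1 F]/(slice_int l (iint r l F)) slice_intC//; last by rewrite gt_eqF.
    by apply: slice_int_ge0 => // z cz; apply: IH => //; exact: ltnW.
  exact: bmeas_iint.
elim: k ik x => // k IH; rewrite ltnS leq_eqVlt => /predU1P[<- x|ik x cx].
  exact: Fk.
by apply: slice_int_ge0 => // y; exact: IH.
Qed.

End SliceIntegral.

Section OneDimensional.
Context {R : realType}.
Notation mu := (@lebesgue_measure R).

Lemma Rintegral_itv_split (f : R -> R) (a c b : R) : a <= c -> c <= b ->
  mu.-integrable `[a, b]%classic (EFin \o f) ->
  Rintegral mu `[a, b]%classic f =
    Rintegral mu `[a, c]%classic f + Rintegral mu `[c, b]%classic f.
Proof.
move=> ac cb intf; apply/eqP; rewrite addrC -subr_eq; apply/eqP.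
rewrite (@Rintegral_itvB _ _ (BLeft a) (BRight b) c)//.
rewrite -Rintegral_itv_obnd_cbnd//; apply: integrableS intf => //.
by apply: subset_itvr; rewrite bnd_simp.
Qed.

Lemma Rintegral_antiderivative (F f g : R -> R) (a b : R) : a <= b ->
  (forall t, t \in `[a, b] -> derivable F t 1 /\ 'D_1 F t = f t) ->
  (forall t, t \in `[a, b] -> {for t, continuous f}) ->
  mu.-integrable `[a, b]%classic (EFin \o g) ->
  (forall t, t \in `]a, b[ -> g t = f t) ->
  Rintegral mu `[a, b]%classic g = F b - F a.
Proof.
rewrite le_eqVlt => /predU1P[-> _ _ _ _|ab dF cf intg gf].
  by rewrite set_itv1 Rintegral_set1 subrr.
have cF t : t \in `[a, b] -> {for t, continuous F}.
  by move=> tab; apply/differentiable_continuous/derivable1_diffP; have [] := dF t tab.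
have wf : {within `[a, b], continuous f}.
  by apply: continuous_in_subspaceT => t; rewrite inE => /cf.
have intf : mu.-integrable `[a, b]%classic (EFin \o f).
  by apply: continuous_compact_integrable => //; exact: segment_compact.
have S b0 b1 : [set` Interval (BSide b0 a) (BSide b1 b)] `<=` `[a, b]%classic.
  by move=> t /=; apply: subset_itvScc; rewrite bnd_simp.
transitivity (Rintegral mu `[a, b]%classic f).
  rewrite -!Rintegral_itv_bndo_bndc;
    do ?by [apply: integrableS intf => //; exact: S|apply: integrableS intg => //; exact: S].
  rewrite -!Rintegral_itv_obnd_cbnd;
    do ?by [apply: integrableS intf => //; exact: S|apply: integrableS intg => //; exact: S].
  by apply: eq_Rintegral => t; rewrite inE; exact: gf.
rewrite /Rintegral (continuous_FTC2 ab wf (F := F))//.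
- split.
  + by move=> t /subset_itv_oo_cc /dF[].
  + apply: cvg_at_right_filter; apply: cF; rewrite in_itv/= lexx ltW//.
  + apply: cvg_at_left_filter; apply: cF; rewrite in_itv/= lexx ltW//.
- by move=> t /subset_itv_oo_cc /dF[_ <-]; rewrite derive1E.
Qed.

(* Integration by parts against the profile [(r - max m |t|)^2 / 2], whose second
   derivative is [w] minus point masses [r - m] at [m] and [- m]. *)
Lemma Rintegral_profile (r m : R) (p p1 p2 w : R -> R) :
  0 <= m -> m <= r ->
  (forall t, t \in `[- r, r] -> is_derive t 1 p (p1 t)) ->
  (forall t, t \in `[- r, r] -> is_derive t 1 p1 (p2 t)) ->
  (forall t, t \in `[- r, r] -> {for t, continuous p2}) ->
  (forall t, m < `|t| -> w t = 1) -> (forall t, `|t| < m -> w t = 0) ->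
  let g t := w t * p t - (r - Num.max m `|t|) ^+ 2 / 2 * p2 t in
  mu.-integrable `[- r, r]%classic (EFin \o g) ->
  Rintegral mu `[- r, r]%classic g = (r - m) * (p m + p (- m)).
Proof.
move=> m0 mr dp dp1 cp2 w1 w0 g intg.
have r0 : 0 <= r by exact: le_trans mr.
have cp t : t \in `[- r, r] -> {for t, continuous p}.
  by move=> tab; apply/differentiable_continuous/derivable1_diffP; have [] := dp t tab.
have S a b t : - r <= a -> b <= r -> t \in `[a, b] -> t \in `[- r, r].
  by rewrite !in_itv/= => ? ? /andP[? ?]; apply/andP; split; lra.
have I a b : - r <= a -> b <= r -> mu.-integrable `[a, b]%classic (EFin \o g).
  by move=> ra br; apply: integrableS intg => // t; exact: S.
rewrite (Rintegral_itv_split _ _ (- m))//; [|lra..].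
rewrite (Rintegral_itv_split _ (- m) m)//; [|lra..|by apply: I; lra].
pose F1 : R -> R := (cst r + id) * p - (2^-1 *: (cst r + id) ^+ 2) * p1.
pose F2 : R -> R := - ((r - m) ^+ 2 / 2) *: p1.
pose F3 : R -> R := - ((cst r - id) * p) - (2^-1 *: (cst r - id) ^+ 2) * p1.
have dF1 t : t \in `[- r, r] -> is_derive t 1 F1 (p t - (r + t) ^+ 2 / 2 * p2 t).
  move=> tr; have ? := dp t tr; have ? := dp1 t tr; apply: is_derive_eq.
  by rewrite !fctE /GRing.scale /= expr1; field.
have dF2 t : t \in `[- r, r] -> is_derive t 1 F2 (- ((r - m) ^+ 2 / 2) * p2 t).
  by move=> tr; have ? := dp1 t tr; apply: is_derive_eq.
have dF3 t : t \in `[- r, r] -> is_derive t 1 F3 (p t - (r - t) ^+ 2 / 2 * p2 t).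
  move=> tr; have ? := dp t tr; have ? := dp1 t tr; apply: is_derive_eq.
  by rewrite !fctE /GRing.scale /= expr1; field.
have cdiff (v : R -> R) t : t \in `[- r, r] -> {for t, continuous v} ->
    {for t, continuous (fun s => p s - v s ^+ 2 / 2 * p2 s)}.
  move=> tr cv; apply: cvgB; first exact: cp.
  apply: cvgM; last exact: cp2.
  apply: cvgM; last exact: cvg_cst.
  by rewrite expr2; under eq_fun do rewrite expr2; exact: cvgM.
have -> : Rintegral mu `[- r, - m]%classic g = F1 (- m) - F1 (- r).
  apply: (Rintegral_antiderivative F1 (fun t => p t - (r + t) ^+ 2 / 2 * p2 t)); first last.
  - move=> t; rewrite in_itv/= => /andP[rt tm]; rewrite /g w1 ?mul1r ?ler0_norm//; try lra.
    by rewrite max_r; [rewrite opprK|lra].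
  - by apply: I; lra.
  - move=> t ti; apply: cdiff; first by apply: S ti; lra.
    by apply: cvgD; [exact: cvg_cst|exact: cvg_id].
  - by move=> t ti; case: (dF1 t) => //; apply: S ti; lra.
  - by lra.
have -> : Rintegral mu `[- m, m]%classic g = F2 m - F2 (- m).
  apply: (Rintegral_antiderivative F2 (fun t => - ((r - m) ^+ 2 / 2) * p2 t)); first last.
  - move=> t; rewrite in_itv/= => /andP[rt tm].
    have tm' : `|t| < m by rewrite ltr_norml rt tm.
    by rewrite /g w0// mul0r sub0r mulNr max_l ?ltW.
  - by apply: I; lra.
  - move=> t ti; apply: cvgM; first exact: cvg_cst.
    by apply: cp2; apply: S ti; lra.
  - by move=> t ti; case: (dF2 t) => //; apply: S ti; lra.
  - by lra.
have -> : Rintegral mu `[m, r]%classic g = F3 r - F3 m.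
  apply: (Rintegral_antiderivative F3 (fun t => p t - (r - t) ^+ 2 / 2 * p2 t)); first last.
  - move=> t; rewrite in_itv/= => /andP[rt tm]; rewrite /g w1 ?mul1r ?ger0_norm//; try lra.
    by rewrite max_r//; lra.
  - by apply: I; lra.
  - move=> t ti; apply: cdiff; first by apply: S ti; lra.
    by apply: cvgB; [exact: cvg_cst|exact: cvg_id].
  - by move=> t ti; case: (dF3 t) => //; apply: S ti; lra.
  - by lra.
by rewrite /F1 /F2 /F3 !fctE /GRing.scale /=; field.
Qed.

End OneDimensional.

Section SupNorm.
Context {R : realType} {n : nat}.
Implicit Types (x y : 'rV[R]_n) (i j k : 'I_n).

Lemma le_normr_row x j : `|x 0 j| <= `|x|.
Proof.
rewrite [leRHS]/Num.norm /= mx_normrE; apply/bigmax_geP; right => /=.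
by exists (0, j).
Qed.

Lemma normr_row_leP x (e : R) : 0 <= e ->
  (`|x| <= e) <-> (forall j, `|x 0 j| <= e).
Proof.
move=> e0; split=> [xe j|xe]; first exact: le_trans (le_normr_row x j) xe.
rewrite [leLHS]/Num.norm /= mx_normrE; apply/bigmax_leP; split => // -[a j] _ /=.
by rewrite ord1.
Qed.

Lemma cube_normE (r : R) x : 0 <= r -> cube r x <-> `|x| <= r.
Proof. by move=> r0; apply: iff_sym; exact: normr_row_leP. Qed.

Lemma setcoord_same i (t : R) x : setcoord i t x 0 i = t.
Proof. by rewrite mxE eqxx. Qed.

Lemma setcoord_other i j (t : R) x : j != i -> setcoord i t x 0 j = x 0 j.
Proof. by rewrite mxE -val_eqE => /negbTE ->. Qed.

Lemma normr_setcoord i (t : R) x :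
  `|setcoord i t x| = Num.max `|setcoord i 0 x| `|t|.
Proof.
apply/eqP; rewrite eq_le; apply/andP; split.
  apply/normr_row_leP => [|j]; first by rewrite le_max normr_ge0.
  rewrite le_max; have [->|ji] := eqVneq j i.
    by rewrite setcoord_same lexx orbT.
  by rewrite setcoord_other// -(setcoord_other i j 0)// le_normr_row.
rewrite ge_max; apply/andP; split; last by rewrite -{1}(setcoord_same i t x) le_normr_row.
apply/normr_row_leP => // j; have [->|ji] := eqVneq j i.
  by rewrite setcoord_same normr0.
by rewrite setcoord_other// -(setcoord_other i j t)// le_normr_row.
Qed.

Lemma normr_setcoord_attained i x : (2 <= n)%N ->
  exists2 j, j != i & `|x 0 j| = `|setcoord i 0 x|.
Proof.
move=> n2.
have [j0 j0i] : exists j, j != i.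
  have n0 : (0 < n)%N by exact: ltnW.
  have [i0|i0] := eqVneq (val i) 0%N.
    by exists (Ordinal n2); rewrite -val_eqE /= i0.
  by exists (Ordinal n0); rewrite -val_eqE /= eq_sym.
case: (@Order.TotalTheory.arg_maxP _ _ _ j0 (fun k => k != i) (fun k => `|x 0 k|) j0i) => j ji jmax.
exists j => //; apply/eqP; rewrite eq_le; apply/andP; split.
  by rewrite -(setcoord_other i j 0)// le_normr_row.
apply/normr_row_leP => // k; have [->|ki] := eqVneq k i.
  by rewrite setcoord_same normr0.
by rewrite setcoord_other//; exact: jmax.
Qed.

Lemma setcoord_Dn (r : R) i x (s : R) : (2 <= n)%N -> cube r x ->
  `|s| = `|setcoord i 0 x| -> s \in `[- r, r] -> Dn r (setcoord i s x).
Proof.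
move=> n2 cx sE sr; have [j ji xj] := normr_setcoord_attained i x n2.
have cs := cube_setcoord r i s x cx sr.
have k_le k : `|setcoord i s x 0 k| <= `|s|.
  have := le_normr_row (setcoord i s x) k.
  by rewrite normr_setcoord -sE maxxx.
have xi : `|setcoord i s x 0 i| = `|s| by rewrite setcoord_same.
have xj' : `|setcoord i s x 0 j| = `|s| by rewrite setcoord_other// xj sE.
have [ij|] := ltnP i j; first exists i, j.
  by split => //; split => //; rewrite xi xj'; split.
rewrite leq_eqVlt val_eqE (negbTE ji) /= => lji; exists j, i.
by split => //; split => //; rewrite xi xj'; split.
Qed.

(* Ties go to the smallest index, so that the cells partition the space exactly. *)
Definition cell i x : R :=
  [forall k : 'I_n, if (k < i)%N then `|x 0 k| < `|x 0 i| else `|x 0 k| <= `|x 0 i|]%:R.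

Lemma sum_cell x : (0 < n)%N -> \sum_i cell i x = 1.
Proof.
move=> n0.
have [i0 i0max] : exists i0, [forall k, `|x 0 k| <= `|x 0 i0|].
  case: (@Order.TotalTheory.arg_maxP _ _ _ (Ordinal n0) xpredT (fun k => `|x 0 k|) isT) => i _ imax.
  by exists i; apply/forallP => k; exact: imax.
case: (@arg_minnP _ i0 (fun i => [forall k, `|x 0 k| <= `|x 0 i|]) val i0max).
move=> i /forallP imax imin.
have lt_i k : (k < i)%N -> `|x 0 k| < `|x 0 i|.
  move=> ki; rewrite ltNge; apply/negP => ik.
  have /imin : [forall l, `|x 0 l| <= `|x 0 k|].
    by apply/forallP => l; exact: le_trans (imax l) ik.
  by rewrite leqNgt ki.
rewrite (bigD1 i)//= big1 => [|j ji].
  rewrite addr0 /cell (_ : [forall _, _])//; apply/forallP => k.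
  by case: ifP => [/lt_i|].
rewrite /cell (_ : [forall _, _] = false)//; apply/negbTE/forallPn; exists i.
case: ifP => ij; first by rewrite -leNgt.
have /lt_i : (j < i)%N by rewrite ltn_neqAle leqNgt ij andbT.
by rewrite -ltNge.
Qed.

Lemma cell_setcoord1 i x (t : R) : `|setcoord i 0 x| < `|t| ->
  cell i (setcoord i t x) = 1.
Proof.
move=> xt; rewrite /cell (_ : [forall _, _])//; apply/forallP => k.
rewrite setcoord_same; have [->|ki] := eqVneq k i.
  by rewrite ltnn setcoord_same.
have : `|x 0 k| < `|t|.
  by apply: le_lt_trans xt; rewrite -(setcoord_other i k 0)// le_normr_row.
by rewrite setcoord_other//; case: ifP => // _ /ltW.
Qed.

Lemma cell_setcoord0 i x (t : R) : `|t| < `|setcoord i 0 x| ->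
  cell i (setcoord i t x) = 0.
Proof.
move=> tx; rewrite /cell (_ : [forall _, _] = false)//; apply/negbTE/negP => /forallP tmax.
have : `|setcoord i t x| <= `|t|.
  apply/normr_row_leP => // k; have := tmax k; rewrite setcoord_same.
  by case: ifP => // _ /ltW.
by rewrite normr_setcoord ge_max leNgt tx.
Qed.

Lemma bmeas_cell i : bounded_measurable (cell i).
Proof.
split; last first.
  by exists 1 => x; rewrite /cell; case: forallP => _; rewrite ?normr1 ?normr0.
move=> d T phi mphi.
pose b k (t : T) := if (k < i)%N then `|phi k t| < `|phi i t| else `|phi k t| <= `|phi i t|.
have mb k : measurable_fun setT (b k).
  rewrite /b; case: (k < i)%N.
    by apply: measurable_fun_ltr; apply: measurableT_comp => //; exact: mphi.
  by apply: measurable_fun_ler; apply: measurableT_comp => //; exact: mphi.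
rewrite (_ : (fun t => _) = fun t => \prod_k (if b k t then 1 else 0)).
  apply: measurable_prod => k _; apply: measurable_fun_ifT; first exact: mb.
    exact: measurable_cst.
  exact: measurable_cst.
apply/funext => t; rewrite /cell.
have -> : [forall k : 'I_n, if (k < i)%N
    then `|(\row_j phi j t) 0 k| < `|(\row_j phi j t) 0 i|
    else `|(\row_j phi j t) 0 k| <= `|(\row_j phi j t) 0 i|] = [forall k, b k t].
  by apply: eq_forallb => k; rewrite !mxE.
have [/forallP bt|/forallPn[k /negbTE bk]] := boolP [forall k, b k t].
  by rewrite big1// => k _; rewrite bt.
by rewrite (bigD1 k)//= bk mul0r.
Qed.

End SupNorm.

Section Clamp.
Context {R : realType} {n : nat} (r : R) (r0 : 0 <= r).
Implicit Types x : 'rV[R]_n.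

Definition clamp x : 'rV[R]_n := \row_j Num.max (- r) (Num.min r (x 0 j)).

Lemma cube_clamp x : cube r (clamp x).
Proof.
move=> j; rewrite mxE ler_norml le_max lexx ge_max ge_min lexx /= andbT.
by rewrite -subr_ge0 opprK addr_ge0.
Qed.

Lemma clamp_id x : cube r x -> clamp x = x.
Proof.
move=> cx; apply/rowP => j; rewrite mxE.
have := cx j; rewrite ler_norml => /andP[lx xl].
by rewrite min_r// max_r.
Qed.

Lemma continuous_clamp : continuous clamp.
Proof.
move=> x; apply/(@cvgrPdist_le _ _ _ _ (nbhs_filter x)) => e e0.
apply/nbhs_ballP; exists e => //= y; rewrite -ball_normE /= => /ltW; apply: le_trans.
apply/normr_row_leP => // j; have := le_normr_row (x - y) j.
rewrite !mxE; apply: le_trans; move: (x 0 j) (y 0 j) => a b.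
rewrite !maxElt !minElt ler_norml.
case: (ltP r a) => ?; case: (ltP r b) => ?; case: (ltP (- r) r) => ?;
  case: (ltP (- r) a) => ?; case: (ltP (- r) b) => ?;
  case: (ger0P (a - b)) => ?; apply/andP; split; lra.
Qed.

Lemma bmeas_clamp (F : 'rV[R]_n -> R) : {within cube r, continuous F} ->
  bounded_measurable (F \o clamp).
Proof.
move=> /subspace_continuousP cF.
have cFc : continuous (F \o clamp).
  move=> x; apply: cvg_comp (cF _ (cube_clamp x)) => B /= wB.
  have /nbhs_ballP[e e0 eB] : nbhs x (clamp @^-1` [set y | cube r y -> B y]).
    exact: continuous_clamp wB.
  suff : nbhs x (clamp @^-1` B) by [].
  by apply/nbhs_ballP; exists e => // y /eB; apply; exact: cube_clamp.
split; first exact: continuous_coord_measurable.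
have cpt : compact (cube r : set 'rV[R]_n).
  have := @rV_compact R n (fun=> `[- r, r]%classic) (fun=> @segment_compact _ _ _).
  by congr compact; apply/seteqP; split => x /= h j; have := h j; rewrite in_itv/= ler_norml.
have /compact_bounded[M [_ MF]] : compact ((F \o clamp) @` cube r).
  by apply: continuous_compact => //; exact: continuous_subspaceT.
exists (M + 1) => x; apply: (MF (M + 1)); first by rewrite ltrDl.
exists (clamp x); first exact: cube_clamp.
by rewrite /= (clamp_id (clamp x))//; exact: cube_clamp.
Qed.

End Clamp.

Section HarmonicCube.
Context {R : realType} {n : nat} (r : R).
Implicit Types (h : 'rV[R]_n -> R) (x : 'rV[R]_n).

Lemma is_derive_setcoord h (i : 'I_n) x (t : R) :
  derivable h (setcoord i t x) (evec R i) ->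
  is_derive t 1 (fun s => h (setcoord i s x)) (pd i h (setcoord i t x)).
Proof.
have E : (fun e : R => e^-1 *: (h (setcoord i (e *: 1 + t) x) - h (setcoord i t x))) =
    (fun e => e^-1 *: (h (e *: evec R i + setcoord i t x) - h (setcoord i t x))).
  by apply/funext => e; rewrite setcoord_delta [e *: 1]mulr1.
move=> dh; split.
  by rewrite /derivable /= E.
by rewrite /pd /derive /= E.
Qed.

Lemma continuous_setcoord (i : 'I_n) x : continuous (fun t : R => setcoord i t x).
Proof.
rewrite (_ : (fun t => _) = fun t => t *: evec R i + setcoord i 0 x).
  by move=> t; apply: cvgD; [apply: cvgZr_tmp; exact: cvg_id|exact: cvg_cst].
by apply/funext => t; rewrite -setcoord_delta addr0.
Qed.

Lemma harmonic_near_cube h : harmonic_near (cube r) h ->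
  [/\ {within cube r, continuous h},
      forall i : 'I_n, {within cube r, continuous (pd i (pd i h))},
      forall x, cube r x -> forall i : 'I_n,
        [/\ derivable h x (evec R i), derivable (pd i h) x (evec R i) &
            {for x, continuous (pd i (pd i h))}] &
      forall x, cube r x -> laplacian h x = 0].
Proof.
move=> [U [oU cU C2 lap]]; split.
- by apply: continuous_in_subspaceT => x; rewrite inE => /cU /C2[].
- by move=> i; apply: continuous_in_subspaceT => x; rewrite inE => /cU /C2[_] /(_ i i)[].
- by move=> x /cU /C2[_ C] i; have [] := C i i.
- by move=> x /cU /lap.
Qed.

Lemma iint_diff_ge0 (h1 h2 : 'rV[R]_n -> R) : (2 <= n)%N -> 0 < r ->
  harmonic_near (cube r) h1 -> harmonic_near (cube r) h2 ->
  (forall x, Dn r x -> h2 x <= h1 x) ->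
  0 <= iint r n (fun x => h1 (clamp r x) - h2 (clamp r x)) 0.
Proof.
move=> n2 r0 /harmonic_near_cube[c1 cc1 d1 l1] /harmonic_near_cube[c2 cc2 d2 l2] h21.
have r0' := ltW r0.
pose c := @clamp R n r.
pose u (x : 'rV[R]_n) : R := (r - `|x|) ^+ 2 / 2.
pose H (i : 'I_n) x := cell i x * (h1 (c x) - h2 (c x)) -
  u (c x) * (pd i (pd i h1) (c x) - pd i (pd i h2) (c x)).
have cu : {within cube r, continuous u}.
  apply: continuous_subspaceT => x.
  apply: (continuous_comp (@norm_continuous _ _ x) (g := fun s => (r - s) ^+ 2 / 2)).
  apply: cvgM; last exact: cvg_cst.
  rewrite expr2; under eq_fun do rewrite expr2.
  by apply: cvgM; apply: cvgB; first [exact: cvg_cst|exact: cvg_id].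
have bh1 := bmeas_clamp r r0' h1 c1.
have bh2 := bmeas_clamp r r0' h2 c2.
have bH i : bounded_measurable (H i).
  apply: bmeasB; apply: bmeasM.
  - exact: bmeas_cell.
  - exact: bmeasB.
  - exact: (bmeas_clamp r r0' u cu).
  - by apply: bmeasB; [exact: (bmeas_clamp r r0' _ (cc1 i))|exact: (bmeas_clamp r r0' _ (cc2 i))].
have cube0 : cube r (0 : 'rV[R]_n) by move=> j; rewrite mxE normr0.
have sumH x : cube r x -> h1 (c x) - h2 (c x) = \sum_i H i x.
  move=> cx; rewrite big_split/= -mulr_suml sum_cell; last exact: ltnW.
  rewrite mul1r sumrN -mulr_sumr sumrB /c clamp_id//.
  have E (a s1 s2 v : R) : s1 = 0 -> s2 = 0 -> a = a - v * (s1 - s2).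
    by move=> -> ->; rewrite subrr mulr0 subr0.
  by apply: E; [exact: l1|exact: l2].
rewrite (eq_iint r n _ (fun x => \sum_i H i x))// iint_sum//.
apply: sumr_ge0 => i _; apply: (iint_ge0 r n i) => // x cx.
set m := `|setcoord i 0 x|.
have m0 : 0 <= m by exact: normr_ge0.
have mr : m <= r.
  by apply/cube_normE => //; apply: cube_setcoord => //; rewrite in_itv/= oppr_le0 r0'.
pose y t := setcoord i t x.
have cy t : t \in `[- r, r] -> cube r (y t) by exact: cube_setcoord.
pose p t := h1 (y t) - h2 (y t).
pose p1 t := pd i h1 (y t) - pd i h2 (y t).
pose p2 t := pd i (pd i h1) (y t) - pd i (pd i h2) (y t).
have HE t : t \in `[- r, r] ->
    H i (y t) = cell i (y t) * p t - (r - Num.max m `|t|) ^+ 2 / 2 * p2 t.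
  by move=> tr; rewrite /H /u /c (clamp_id r (y t) (cy t tr)) [`|y t|]normr_setcoord.
have intH := integrable_slice r i (H i) x (bH i).
have dp t : t \in `[- r, r] -> is_derive t 1 p (p1 t).
  move=> /cy /[dup] /d1 /(_ i)[k1 _ _] /d2 /(_ i)[k2 _ _].
  have := is_derive_setcoord h2 i x t k2; have := is_derive_setcoord h1 i x t k1.
  exact: is_deriveB.
have dp1 t : t \in `[- r, r] -> is_derive t 1 p1 (p2 t).
  move=> /cy /[dup] /d1 /(_ i)[_ k1 _] /d2 /(_ i)[_ k2 _].
  have := is_derive_setcoord (pd i h2) i x t k2.
  have := is_derive_setcoord (pd i h1) i x t k1.
  exact: is_deriveB.
have cp2 t : t \in `[- r, r] -> {for t, continuous p2}.
  move=> /cy /[dup] /d1 /(_ i)[_ _ k1] /d2 /(_ i)[_ _ k2].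
  have e1 := continuous_comp (continuous_setcoord i x t) k1.
  have e2 := continuous_comp (continuous_setcoord i x t) k2.
  exact: (cvgB e1 e2).
have intg : lebesgue_measure.-integrable `[- r, r]%classic (EFin \o
    (fun t => cell i (y t) * p t - (r - Num.max m `|t|) ^+ 2 / 2 * p2 t)).
  apply: eq_integrable intH; first exact: measurable_itv.
  by move=> t /set_mem tr; exact: (congr1 EFin (HE t tr)).
have -> : slice_int r i (H i) x = (r - m) * (p m + p (- m)).
  rewrite -(@Rintegral_profile R r m p p1 p2 (fun t => cell i (y t)) m0 mr dp dp1 cp2
    (fun t => cell_setcoord1 i x t) (fun t => cell_setcoord0 i x t) intg).
  by apply: eq_Rintegral => t /set_mem tr; exact: (HE t tr).
have p_ge0 s : `|s| = m -> 0 <= p s.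
  move=> sm; rewrite subr_ge0; apply/h21/(setcoord_Dn r i x s n2 cx sm).
  by rewrite in_itv/= -ler_norml sm.
apply: mulr_ge0; first by rewrite subr_ge0.
by apply: addr_ge0; apply: p_ge0; rewrite ?normrN ger0_norm.
Qed.

End HarmonicCube.

Theorem theorem3 (R : realType) (n : nat) (r : R)
  (f hstar : 'rV[R]_n -> R) :
  (2 <= n)%N -> 0 < r ->
  {within cube r, continuous f} ->
  harm_minorant r f hstar ->
  (forall x, Dn r x -> f x - hstar x = 0) ->
  forall h : 'rV[R]_n -> R, harm_minorant r f h ->
    L1norm r (fun x => f x - hstar x) <= L1norm r (fun x => f x - h x).
Proof.
move=> n2 r0 cf [hs_harm hs_le] f_hs h [h_harm h_le].
have r0' := ltW r0.
have cube0 : cube r (0 : 'rV[R]_n) by move=> j; rewrite mxE normr0.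
have bf := bmeas_clamp r r0' f cf.
have bm g : harmonic_near (cube r) g -> bounded_measurable (g \o clamp r).
  by move=> /harmonic_near_cube[cg _ _ _]; exact: bmeas_clamp.
have L1E g : harm_minorant r f g ->
    L1norm r (fun x => f x - g x) = iint r n (f \o clamp r) 0 - iint r n (g \o clamp r) 0.
  move=> [g_harm g_le]; rewrite -iintB//; last exact: bm.
  apply: eq_iint => // x cx.
  by rewrite /= clamp_id// ger0_norm// subr_ge0 g_le.
rewrite !L1E// lerD2l lerN2 -subr_ge0 -iintB; [|exact: bm..].
apply: iint_diff_ge0 => // x Dx.
have /eqP := f_hs x Dx; rewrite subr_eq0 => /eqP <-.
by case: Dx => i [j [_ [cx _]]]; exact: h_le.
Qed.
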